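(* Let $X,Y$ be simplicial Malcev algebras and let $\alpha:X\to Y$ be a morphism of simplicial Malcev algebras that has a degeneracy-section. Then (the underlying map of simplicial sets of) $\alpha$ is a degenerate-preferring Kan fibration, i.e. there is a function $\mathrm{lift}$ making $(\alpha,\mathrm{lift})$ a degenerate-preferring Kan fibration.
   Context: Simplicial sets. $\Delta$ is the simplex category; $s_i:[n+1]\to[n]$ ($0\le i\le n$) is the surjective order-preserving map hitting $i$ twice, and $d_i$ is the injective order-preserving map skipping $i$. Elements $p\in X_n$ of a simplicial set are identified with maps $p:\Delta^n\to X$, and for $f:[m]\to[n]$ we write $p\circ f\in X_m$ for the result of the simplicial action. For $n\ge1$ and $0\le m\le n$, the horn $\Lambda^n_m\subseteq\Delta^n$ is the union of the faces $d_k$ with $k\neq m$, and $\iota:\Lambda^n_m\hookrightarrow\Delta^n$ is the horn inclusion. A Malcev algebra is a set with a ternary operation $\mu$ satisfying $\mu(x,x,y)=y$ and $\mu(x,y,y)=x$. A simplicial Malcev algebra is a functor from $\Delta^{op}$ to the category of Malcev algebras (and homomorphisms); a morphism of such is a natural transformation. Degeneracy-section. For a map $\alpha:X\to Y$ of simplicial sets, a degeneracy-section is a family of functions $\beta=(\beta_n:Y_n\to X_n)_{n\in\mathbb N}$ (not required to be homomorphisms or to commute with face maps) such that for all $n$: $\alpha_n\circ\beta_n=1_{Y_n}$, and $\beta_{n+1}(y\circ s_k)=\beta_n(y)\circ s_k$ for all $y\in Y_n$, $0\le k\le n$. Kan fibrations. A functional Kan fibration is a map $\alpha:X\to Y$ of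 simplicial sets together with a function $\mathrm{lift}$ assigning to every horn inclusion $\iota:\Lambda^n_m\hookrightarrow\Delta^n$ and every pair $x:\Lambda^n_m\to X$, $y:\Delta^n\to Y$ with $\alpha\circ x=y\circ\iota$ a map $\mathrm{lift}(x,y):\Delta^n\to X$ with $\mathrm{lift}(x,y)\circ\iota=x$ and $\alpha\circ\mathrm{lift}(x,y)=y$. It is a degenerate-preferring Kan fibration if, whenever a lifting problem $(x,y)$ has a solution of the form $z\circ s_j$ for some $z\in X_{n-1}$ and $0\le j\le n-1$, then $\mathrm{lift}(x,y)$ is such a solution (such degenerate solutions are unique when they exist). *)

(* Defs.v *)
From HB Require Import structures.
From mathcomp Require Import all_boot.
From mathcomp Require Import boolp.

Set Implicit Arguments.
Unset Strict Implicit.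
Unset Printing Implicit Defensive.

(* [n] is 'I_n.+1.  Finite functions with a boolean monotonicity predicate make
   Leibniz equality of morphisms extensional and hom-sets finite. *)
Definition monotoneb m n (f : {ffun 'I_m.+1 -> 'I_n.+1}) : bool :=
  [forall i : 'I_m.+1, forall j : 'I_m.+1, (i <= j) ==> (f i <= f j)].

Record simplex_hom m n := SimplexHom {
  simplex_fun :> {ffun 'I_m.+1 -> 'I_n.+1};
  simplex_funP : monotoneb simplex_fun }.

HB.instance Definition _ m n := [isSub for @simplex_fun m n].
HB.instance Definition _ m n := [Finite of simplex_hom m n by <:].

Lemma simplex_hom_mono m n (f : simplex_hom m n) (i j : 'I_m.+1) :
  i <= j -> f i <= f j.
Proof. by move=> le_ij; have /forallP/(_ i)/forallP/(_ j)/implyP := simplex_funP f; apply. Qed.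

Lemma simplex_homP m n (f g : simplex_hom m n) : f =1 g <-> f = g.
Proof. by split=> [fg|->//]; apply/val_inj/ffunP. Qed.

Lemma monotonebP m n (f : 'I_m.+1 -> 'I_n.+1) :
  (forall i j : 'I_m.+1, i <= j -> f i <= f j) -> monotoneb [ffun i => f i].
Proof.
by move=> fP; apply/forallP => i; apply/forallP => j; apply/implyP; rewrite !ffunE; apply: fP.
Qed.

Definition mk_simplex_hom m n (f : 'I_m.+1 -> 'I_n.+1)
    (fP : forall i j : 'I_m.+1, i <= j -> f i <= f j) : simplex_hom m n :=
  SimplexHom (monotonebP fP).

Lemma mk_simplex_homE m n (f : 'I_m.+1 -> 'I_n.+1) fP : mk_simplex_hom (f := f) fP =1 f.
Proof. by move=> i; rewrite ffunE. Qed.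

Definition simplex_id n : simplex_hom n n :=
  mk_simplex_hom (f := id) (fun _ _ le_ij => le_ij).

Definition simplex_comp l m n (f : simplex_hom m n) (g : simplex_hom l m) :
    simplex_hom l n :=
  mk_simplex_hom (f := f \o g)
    (fun _ _ le_ij => simplex_hom_mono f (simplex_hom_mono g le_ij)).

Lemma simplex_compE l m n (f : simplex_hom m n) (g : simplex_hom l m) i :
  simplex_comp f g i = f (g i).
Proof. exact: mk_simplex_homE. Qed.

Lemma simplex_compf1 m n (f : simplex_hom m n) : simplex_comp f (simplex_id m) = f.
Proof. by apply/simplex_homP => i; rewrite simplex_compE mk_simplex_homE. Qed.

Lemma simplex_compA k l m n (f : simplex_hom m n) (g : simplex_hom l m)
    (h : simplex_hom k l) :
  simplex_comp (simplex_comp f g) h = simplex_comp f (simplex_comp g h).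
Proof. by apply/simplex_homP => i; rewrite !simplex_compE. Qed.

Lemma face_mono n (k : 'I_n.+2) (i j : 'I_n.+1) : i <= j -> lift k i <= lift k j.
Proof. by rewrite /= leq_bump2. Qed.

(* the injection d_k : [n] -> [n+1] skipping k *)
Definition face n (k : 'I_n.+2) : simplex_hom n n.+1 := mk_simplex_hom (@face_mono n k).

Lemma degen_subproof n (k : 'I_n.+1) (i : 'I_n.+2) : unbump k i < n.+1.
Proof.
rewrite /unbump; case: (ltnP k i) => [lt_ki|le_ik] /=.
  by rewrite subn1 prednK ?(leq_ltn_trans _ lt_ki) // -ltnS ltn_ord.
by rewrite subn0 (leq_ltn_trans le_ik).
Qed.

Lemma degen_mono n (k : 'I_n.+1) (i j : 'I_n.+2) :
  i <= j -> Ordinal (degen_subproof k i) <= Ordinal (degen_subproof k j).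
Proof.
move=> le_ij; rewrite /= /unbump.
case: (ltnP k i) => ki; case: (ltnP k j) => kj /=; rewrite ?subn0 ?subn1 //.
- by case: (nat_of_ord i) (nat_of_ord j) le_ij => [|a] [|b].
- by rewrite (leq_trans (leq_pred _)).
- by rewrite (leq_trans ki) // -ltnS (ltn_predK kj).
Qed.

(* the surjection s_k : [n+1] -> [n] hitting k twice *)
Definition degen n (k : 'I_n.+1) : simplex_hom n.+1 n := mk_simplex_hom (@degen_mono n k).

(* [sact p f] is the element p \circ f *)
Record sset := SSet {
  sset_obj :> nat -> Type;
  sact : forall m n, sset_obj n -> simplex_hom m n -> sset_obj m;
  sact1 : forall n (p : sset_obj n), sact p (simplex_id n) = p;
  sactM : forall l m n (p : sset_obj n) (f : simplex_hom m n) (g : simplex_hom l m),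
    sact p (simplex_comp f g) = sact (sact p f) g }.

Record sset_map (X Y : sset) := SSetMap {
  sset_map_fun :> forall n, X n -> Y n;
  sset_map_nat : forall m n (p : X n) (f : simplex_hom m n),
    sset_map_fun (sact p f) = sact (sset_map_fun p) f }.

Lemma sset_map_ext (X Y : sset) (a b : sset_map X Y) :
  (forall n (p : X n), a n p = b n p) -> a = b.
Proof.
case: a b => [a aP] [b bP] /= ab; have ab' : a = b.
  by apply: functional_extensionality_dep => n; apply: funext => p.
by case: b / ab' bP {ab} => bP; rewrite (Prop_irrelevance aP bP).
Qed.

Lemma sset_comp_nat (X Y Z : sset) (b : sset_map Y Z) (a : sset_map X Y)
    m n (p : X n) (f : simplex_hom m n) :
  b m (a m (sact p f)) = sact (b n (a n p)) f.
Proof. by rewrite !sset_map_nat. Qed.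

Definition sset_comp (X Y Z : sset) (b : sset_map Y Z) (a : sset_map X Y) :
    sset_map X Z :=
  @SSetMap X Z (fun n p => b n (a n p)) (sset_comp_nat b a).

Definition std_simplex (n : nat) : sset :=
  @SSet (fun k => simplex_hom k n) (fun _ _ p f => simplex_comp p f)
    (fun _ p => simplex_compf1 p) (fun _ _ _ p f g => esym (simplex_compA p f g)).

Lemma yoneda_nat (X : sset) n (p : X n) l m (f : std_simplex n m) (g : simplex_hom l m) :
  sact p (sact f g) = sact (sact p f) g.
Proof. exact: sactM. Qed.

(* the map \Delta^n -> X corresponding to an n-simplex of X *)
Definition yoneda (X : sset) n (p : X n) : sset_map (std_simplex n) X :=
  @SSetMap (std_simplex n) X (fun _ f => sact p f) (@yoneda_nat X n p).

Definition in_horn n (m : 'I_n.+2) k (f : simplex_hom k n.+1) : bool :=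
  [exists j : 'I_n.+2, (j != m) &&
    [exists g : simplex_hom k n, f == simplex_comp (face j) g]].

Lemma in_horn_comp n (m : 'I_n.+2) k l (f : simplex_hom k n.+1) (g : simplex_hom l k) :
  in_horn m f -> in_horn m (simplex_comp f g).
Proof.
case/existsP=> j /andP[jm /existsP[h /eqP->]]; apply/existsP; exists j; rewrite jm.
by apply/existsP; exists (simplex_comp h g); rewrite simplex_compA.
Qed.

Definition horn_obj n (m : 'I_n.+2) k := {f : simplex_hom k n.+1 | in_horn m f}.

Definition horn_act n (m : 'I_n.+2) k l (p : horn_obj m l) (f : simplex_hom k l) :
    horn_obj m k :=
  exist _ (simplex_comp (val p) f) (in_horn_comp f (valP p)).

Lemma horn_act1 n (m : 'I_n.+2) k (p : horn_obj m k) : horn_act p (simplex_id k) = p.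
Proof. by apply: val_inj; rewrite /= simplex_compf1. Qed.

Lemma horn_actM n (m : 'I_n.+2) j k l (p : horn_obj m l) (f : simplex_hom k l)
    (g : simplex_hom j k) :
  horn_act p (simplex_comp f g) = horn_act (horn_act p f) g.
Proof. by apply: val_inj; rewrite /= simplex_compA. Qed.

(* [@horn n m] has dimension n.+1, so that every horn has dimension at least 1. *)
Definition horn n (m : 'I_n.+2) : sset :=
  @SSet (horn_obj m) (@horn_act n m) (@horn_act1 n m) (@horn_actM n m).

Definition horn_incl n (m : 'I_n.+2) : sset_map (horn m) (std_simplex n.+1) :=
  @SSetMap (horn m) (std_simplex n.+1) (fun _ p => val p) (fun _ _ _ _ => erefl).

Record degeneracy_section (X Y : sset) (alpha : sset_map X Y) := DegeneracySection {
  degsec_fun :> forall n, Y n -> X n;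
  degsecK : forall n (y : Y n), alpha n (degsec_fun y) = y;
  degsec_degen : forall n (y : Y n) (k : 'I_n.+1),
    degsec_fun (sact y (degen k)) = sact (degsec_fun y) (degen k) }.

Definition lifting_problem (X Y : sset) (alpha : sset_map X Y) n (m : 'I_n.+2)
    (x : sset_map (horn m) X) (y : sset_map (std_simplex n.+1) Y) : Prop :=
  sset_comp alpha x = sset_comp y (horn_incl m).

Definition lifting_solution (X Y : sset) (alpha : sset_map X Y) n (m : 'I_n.+2)
    (x : sset_map (horn m) X) (y : sset_map (std_simplex n.+1) Y)
    (w : sset_map (std_simplex n.+1) X) : Prop :=
  sset_comp w (horn_incl m) = x /\ sset_comp alpha w = y.

Record functional_kan_fibration (X Y : sset) (alpha : sset_map X Y) := FunctionalKan {
  kan_lift : forall n (m : 'I_n.+2)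
    (x : sset_map (horn m) X) (y : sset_map (std_simplex n.+1) Y),
    lifting_problem alpha x y -> sset_map (std_simplex n.+1) X;
  kan_liftP : forall n (m : 'I_n.+2)
    (x : sset_map (horn m) X) (y : sset_map (std_simplex n.+1) Y)
    (xy : lifting_problem alpha x y), lifting_solution alpha x y (kan_lift xy) }.

Definition degenerate_simplex (X : sset) n (w : sset_map (std_simplex n.+1) X) : Prop :=
  exists (z : X n) (j : 'I_n.+1), w = yoneda (sact z (degen j)).

Definition degenerate_preferring (X Y : sset) (alpha : sset_map X Y)
    (K : functional_kan_fibration alpha) : Prop :=
  forall n (m : 'I_n.+2)
    (x : sset_map (horn m) X) (y : sset_map (std_simplex n.+1) Y)
    (xy : lifting_problem alpha x y),
    (exists w, lifting_solution alpha x y w /\ degenerate_simplex w) ->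
    degenerate_simplex (kan_lift K xy).

Record malcev := Malcev {
  malcev_sort :> Type;
  mu : malcev_sort -> malcev_sort -> malcev_sort -> malcev_sort;
  mu_xxy : forall x y, mu x x y = y;
  mu_xyy : forall x y, mu x y y = x }.

Record malcev_hom (A B : malcev) := MalcevHom {
  malcev_fun :> A -> B;
  malcev_homP : forall x y z,
    malcev_fun (mu x y z) = mu (malcev_fun x) (malcev_fun y) (malcev_fun z) }.

Record smalcev := SMalcev {
  smalcev_obj :> nat -> malcev;
  smalcev_act : forall m n, simplex_hom m n -> malcev_hom (smalcev_obj n) (smalcev_obj m);
  smalcev_act1 : forall n (p : smalcev_obj n), smalcev_act (simplex_id n) p = p;
  smalcev_actM : forall l m n (f : simplex_hom m n) (g : simplex_hom l m)
    (p : smalcev_obj n),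
    smalcev_act (simplex_comp f g) p = smalcev_act g (smalcev_act f p) }.

Record smalcev_map (X Y : smalcev) := SMalcevMap {
  smalcev_map_fun :> forall n, malcev_hom (X n) (Y n);
  smalcev_map_nat : forall m n (f : simplex_hom m n) (p : X n),
    smalcev_map_fun m (smalcev_act X f p) = smalcev_act Y f (smalcev_map_fun n p) }.

Definition smalcev_sset (X : smalcev) : sset :=
  @SSet (fun n => X n) (fun _ _ p f => smalcev_act X f p)
    (@smalcev_act1 X) (fun _ _ _ p f g => smalcev_actM f g p).

Definition smalcev_sset_map (X Y : smalcev) (alpha : smalcev_map X Y) :
    sset_map (smalcev_sset X) (smalcev_sset Y) :=
  @SSetMap (smalcev_sset X) (smalcev_sset Y) (fun n => alpha n)
    (fun _ _ p f => smalcev_map_nat alpha f p).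

(* Main.v *)
Require Import Defs.
From mathcomp Require Import all_boot.
From mathcomp Require Import boolp.

Set Implicit Arguments.
Unset Strict Implicit.
Unset Printing Implicit Defensive.

(** A degeneracy-section makes [alpha] surjective in every dimension, and a
    surjective morphism of simplicial Malcev algebras is a Kan fibration by the
    argument that Moore gave for simplicial groups.  Start from any simplex [p]
    over the base simplex [y] and correct it one face at a time.  If [e]
    retracts the vertices of the simplex onto the face opposite [k], then
    [mu p (p e) (x e)] agrees with the horn [x] on that face, because there
    [e] is the identity and [mu p p x = x]; it still lies over [y], because
    [p e] and [x e] have the same image and [mu y z z = y].  It also keeps the
    values of [p] on a face opposite [j] where [p] agrees with [x] already, as
    long as [e] maps that face into itself, because [p e = x e] there.  Since
    [e] moves only [k], this means that [e k] is not [j].  Moving each vertex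
    [k] one step towards the missing vertex [m], and treating the vertices from
    the two ends of the simplex inwards, respects this condition
    ([malcev_horn_step], [malcev_horn_filler]).

    So every lifting problem has a solution.  A choice function that takes a
    degenerate solution whenever there is one is then a degenerate-preferring
    lift ([degenerate_preferring_of_lifting]). *)

(** * Faces of the simplex as sets of vertices *)

Definition misses k n (f : simplex_hom k n) (j : 'I_n.+1) : Prop :=
  forall i, f i != j.

(** Testing membership in a face on vertices makes it evident which faces a
    collapse preserves, with no appeal to the simplicial identities. *)
Lemma factors_through_face k n (f : simplex_hom k n.+1) (j : 'I_n.+2) :
  misses f j <-> exists g : simplex_hom k n, f = simplex_comp (face j) g.
Proof.
split=> [fj|[g ->] i]; last first.
  by rewrite simplex_compE mk_simplex_homE eq_sym neq_lift.
pose g i := odflt ord0 (unlift j (f i)).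
have gE i : lift j (g i) = f i.
  by rewrite /g; case: unliftP (fj i) => [u ->|->]; rewrite ?eqxx.
have g_mono (a b : 'I_k.+1) : a <= b -> g a <= g b.
  by move=> ab; rewrite -(leq_bump2 j); have := simplex_hom_mono f ab; rewrite -!gE.
exists (mk_simplex_hom g_mono); apply/simplex_homP => i.
by rewrite simplex_compE !mk_simplex_homE.
Qed.

Lemma in_hornP n (m : 'I_n.+2) k (f : simplex_hom k n.+1) :
  in_horn m f <-> exists2 j, j != m & misses f j.
Proof.
split=> [/existsP[j /andP[jm /existsP[g /eqP fE]]]|[j jm fj]].
  by exists j => //; apply/factors_through_face; exists g.
have [g fE] := (factors_through_face f j).1 fj.
by apply/existsP; exists j; rewrite jm; apply/existsP; exists g; apply/eqP.
Qed.

Definition adjacent (i j : nat) : bool := (i == j.+1) || (j == i.+1).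

(** Adjacency is what makes the replacement of [k] by [k'] order-preserving. *)
Lemma collapse_mono n (k k' : 'I_n.+1) (kk' : adjacent k k') (i j : 'I_n.+1) :
  i <= j -> (if i == k then k' else i) <= (if j == k then k' else j).
Proof.
move=> ij; case: (eqVneq i k) (eqVneq j k) => [ik|ik] [jk|jk] //.
- move: ij kk'; rewrite ik leq_eqVlt eq_sym (inj_eq val_inj) (negPf jk) /= => kj.
  by case/orP=> /eqP kE; [apply: ltnW; apply: leq_trans kj; rewrite kE | rewrite kE].
- move: ij kk'; rewrite jk leq_eqVlt (inj_eq val_inj) (negPf ik) /= => ik'.
  by case/orP=> /eqP kE; [rewrite -ltnS -kE | rewrite kE; apply: ltnW; apply: ltnW].
Qed.

Definition collapse n (k k' : 'I_n.+1) (kk' : adjacent k k') : simplex_hom n n :=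
  mk_simplex_hom (collapse_mono kk').

Lemma collapseE n (k k' : 'I_n.+1) (kk' : adjacent k k') i :
  collapse kk' i = if i == k then k' else i.
Proof. exact: mk_simplex_homE. Qed.

Lemma adjacent_neq n (i j : 'I_n.+1) : adjacent i j -> j != i.
Proof. by rewrite -(inj_eq val_inj) => /orP[] /eqP /= ->; rewrite neq_ltn ltnSn ?orbT. Qed.

Lemma collapse_misses n (k k' : 'I_n.+1) (kk' : adjacent k k') :
  misses (collapse kk') k.
Proof.
by move=> i; rewrite collapseE; case: (eqVneq i k) => // _; apply: adjacent_neq kk'.
Qed.

Lemma collapse_id l n (k k' : 'I_n.+1) (kk' : adjacent k k') (g : simplex_hom l n) :
  misses g k -> simplex_comp (collapse kk') g = g.
Proof.
move=> gk; apply/simplex_homP => i.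
by rewrite simplex_compE collapseE (negPf (gk i)).
Qed.

Lemma collapse_preserves l n (k k' j : 'I_n.+1) (kk' : adjacent k k')
    (g : simplex_hom l n) :
  k' != j -> misses g j -> misses (simplex_comp (collapse kk') g) j.
Proof. by move=> k'j gj i; rewrite simplex_compE collapseE; case: ifP. Qed.

(** * Filling horns in simplicial Malcev algebras *)

(** The set [S] records the vertices whose opposite faces have been corrected;
    taking [S] to be all vertices but [m] gives the whole horn. *)
Definition partial_filler (X Y : smalcev) (alpha : smalcev_map X Y)
    n (m : 'I_n.+2) (x : sset_map (horn m) (smalcev_sset X)) (y : Y n.+1)
    (S : pred 'I_n.+2) (p : X n.+1) : Prop :=
  alpha n.+1 p = y /\
  forall l (g : horn m l) j, S j -> misses (val g) j ->
    smalcev_act X (val g) p = x l g.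

(** The Malcev correction of [p] along the face opposite [k].  The condition on
    [k'] keeps the collapse from leaving the faces that already agree. *)
Lemma malcev_horn_step (X Y : smalcev) (alpha : smalcev_map X Y)
    n (m : 'I_n.+2) (x : sset_map (horn m) (smalcev_sset X)) (y : Y n.+1)
    (xy : forall l (g : horn m l), alpha l (x l g) = smalcev_act Y (val g) y)
    (S : pred 'I_n.+2) (k k' : 'I_n.+2) :
  adjacent k k' -> k != m -> ~~ S k' ->
  (exists p, partial_filler alpha x y S p) ->
  exists p, partial_filler alpha x y [pred j | S j || (j == k)] p.
Proof.
move=> kk' km k'S [p [py px]].
pose e := collapse kk'.
have e_horn : in_horn m e by apply/in_hornP; exists k => //; apply: collapse_misses.
pose eh : horn m n.+1 := exist _ e e_horn.
exists (mu p (smalcev_act X e p) (x n.+1 eh)); split.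
  by rewrite malcev_homP py smalcev_map_nat py xy mu_xyy.
move=> l g j Sj gj; rewrite malcev_homP -smalcev_actM.
have -> : smalcev_act X (val g) (x n.+1 eh) = x l (sact eh (val g)).
  by rewrite sset_map_nat.
have [gk|gk] := pselect (misses (val g) k).
  have -> : sact eh (val g) = g by apply: val_inj; rewrite /= collapse_id.
  by rewrite collapse_id // mu_xxy.
have {}Sj : S j by case/orP: Sj => // /eqP jk; rewrite jk in gj.
have k'j : k' != j by apply: contraNneq k'S => ->.
have <- := px l (sact eh (val g)) j Sj (collapse_preserves kk' k'j gj).
by rewrite mu_xyy (px l g j).
Qed.

(** Vertices below [m] are treated in increasing order, each collapsed onto its
    successor, then those above [m] in decreasing order, each collapsed onto its
    predecessor. *)
Lemma malcev_horn_filler (X Y : smalcev) (alpha : smalcev_map X Y)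
    n (m : 'I_n.+2) (x : sset_map (horn m) (smalcev_sset X)) (y : Y n.+1)
    (xy : forall l (g : horn m l), alpha l (x l g) = smalcev_act Y (val g) y) :
  (exists p, alpha n.+1 p = y) ->
  exists p, partial_filler alpha x y (predC1 m) p.
Proof.
move=> [p0 p0y].
have weaken (S T : pred 'I_n.+2) : subpred T S ->
    (exists p, partial_filler alpha x y S p) ->
    exists p, partial_filler alpha x y T p.
  by move=> TS [p [py px]]; exists p; split=> // l g j /TS; apply: px.
have below a : a <= m ->
    exists p, partial_filler alpha x y [pred j : 'I__ | j < a] p.
  elim: a => [|a IHa] am; first by exists p0; split.
  have an : a < n.+2 by apply: ltn_trans am (ltn_ord m).
  have a1n : a.+1 < n.+2 by apply: leq_ltn_trans am (ltn_ord m).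
  have := malcev_horn_step xy (k := Ordinal an) (k' := Ordinal a1n) _ _ _ (IHa (ltnW am)).
  rewrite /adjacent /= eqxx orbT -(inj_eq val_inj) /= ltn_eqF // => /(_ isT isT).
  rewrite ltnNge leqnSn => /(_ isT); apply: weaken => j /=.
  by rewrite ltnS leq_eqVlt orbC -(inj_eq val_inj).
have above b : b + m <= n.+1 ->
    exists p, partial_filler alpha x y [pred j : 'I__ | (j < m) || (n.+1 - b < j)] p.
  elim: b => [|b IHb] bm.
    apply: weaken (below m (leqnn m)) => j /=.
    by rewrite subn0 [n.+1 < j]ltnNge leq_ord orbF.
  (* The vertex to treat next is [n.+1 - b]; its predecessor [c] is the target
     of the collapse, so it must not lie below [m]. *)
  have [c kE] : exists c, n.+1 - b = c.+1.
    by exists (n.+1 - b).-1; rewrite prednK // subn_gt0 (leq_trans _ bm) // addSn ltnS leq_addr.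
  have mc : m <= c by rewrite -ltnS -kE ltn_subRL -addSn.
  have kn : c.+1 < n.+2 by rewrite -kE ltnS leq_subr.
  have := malcev_horn_step xy (k := Ordinal kn) (k' := Ordinal (ltnW kn)) _ _ _ (IHb (ltnW bm)).
  rewrite /adjacent /= eqxx -(inj_eq val_inj) /= gtn_eqF ?ltnS // => /(_ isT isT).
  rewrite kE ltnNge mc ltnNge leqnSn => /(_ isT); apply: weaken => j /=.
  by rewrite subnS kE /= [c < j]leq_eqVlt -(inj_eq val_inj) /= eq_sym orbA orbAC.
have mn : m <= n.+1 by rewrite -ltnS.
apply: weaken (above (n.+1 - m) _); last by rewrite subnK.
by move=> j /=; rewrite subKn // -neq_ltn (inj_eq val_inj).
Qed.

(** Maps out of the standard simplex are determined by their values at the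
    identity, so a filler of the horn is the same as a solution. *)
Lemma malcev_lifting (X Y : smalcev) (alpha : smalcev_map X Y)
    (alpha_surj : forall n (y : Y n), exists x, alpha n x = y)
    n (m : 'I_n.+2) (x : sset_map (horn m) (smalcev_sset X))
    (y : sset_map (std_simplex n.+1) (smalcev_sset Y)) :
  lifting_problem (smalcev_sset_map alpha) x y ->
  exists w, lifting_solution (smalcev_sset_map alpha) x y w.
Proof.
move=> xy; pose y1 : Y n.+1 := y n.+1 (simplex_id n.+1).
have yE l (f : simplex_hom l n.+1) : smalcev_act Y f y1 = y l f.
  apply: etrans (esym (sset_map_nat y (simplex_id n.+1 : std_simplex _ _) f)) _.
  by congr (y l _); apply/simplex_homP => i; rewrite simplex_compE mk_simplex_homE.
have xy1 l (g : horn m l) : alpha l (x l g) = smalcev_act Y (val g) y1.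
  by rewrite yE; apply: (congr1 (fun h : sset_map _ _ => h l g) xy).
have [p [py px]] := malcev_horn_filler xy1 (alpha_surj _ y1).
exists (@yoneda (smalcev_sset X) _ p); split; apply: sset_map_ext => l g /=.
  by have /in_hornP[j jm gj] := valP g; apply: px jm gj.
by rewrite smalcev_map_nat py yE.
Qed.

(** * Preferring degenerate solutions *)

Lemma degenerate_preferring_of_lifting (X Y : sset) (alpha : sset_map X Y) :
  (forall n (m : 'I_n.+2) (x : sset_map (horn m) X)
      (y : sset_map (std_simplex n.+1) Y),
    lifting_problem alpha x y -> exists w, lifting_solution alpha x y w) ->
  exists K : functional_kan_fibration alpha, degenerate_preferring K.
Proof.
move=> lifts.
have best n (m : 'I_n.+2) (x : sset_map (horn m) X)
    (y : sset_map (std_simplex n.+1) Y) (xy : lifting_problem alpha x y) :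
    {w | lifting_solution alpha x y w /\
      ((exists w', lifting_solution alpha x y w' /\ degenerate_simplex w') ->
       degenerate_simplex w)}.
  apply: cid.
  have [[w [wP wdeg]]|nodeg] :=
    pselect (exists w', lifting_solution alpha x y w' /\ degenerate_simplex w').
    by exists w.
  by have [w wP] := lifts _ _ _ _ xy; exists w.
exists (@FunctionalKan _ _ alpha (fun n m x y xy => sval (best n m x y xy))
  (fun n m x y xy => (svalP (best n m x y xy)).1)).
by move=> n m x y xy; apply: (svalP (best n m x y xy)).2.
Qed.

Theorem theorem3p5 (X Y : smalcev) (alpha : smalcev_map X Y)
    (has_section : inhabited (degeneracy_section (smalcev_sset_map alpha))) :
  exists K : functional_kan_fibration (smalcev_sset_map alpha), degenerate_preferring K.
Proof.
case: has_section => beta; apply: degenerate_preferring_of_lifting.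
apply: malcev_lifting => n y; exists (degsec_fun beta y); exact: (degsecK beta y).
Qed.
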